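(* The class of threshold graphs is generalized spectrally closed. That is, if $G$ is a threshold graph (equivalently, $G$ contains no induced subgraph isomorphic to $2K_2$, $P_4$ or $C_4$) and $H$ is a graph that is generalized cospectral with $G$, then $H$ is also a threshold graph.
   Context: All graphs are finite, simple and undirected. $A(G)$ denotes the adjacency matrix of $G$ and $\overline{G}$ its complement. The spectrum of $G$ is the multiset of eigenvalues of $A(G)$; the generalized spectrum of $G$ is the spectrum of $G$ together with the spectrum of $\overline{G}$. Two graphs $G$ and $H$ are generalized cospectral if they have the same generalized spectrum, i.e. $G,H$ have the same spectrum and $\overline{G},\overline{H}$ have the same spectrum. A graph class $\mathcal{C}$ is generalized spectrally closed if no graph in $\mathcal{C}$ is generalized cospectral with a graph outside $\mathcal{C}$. For a family $\mathcal{F}$ of graphs, $\operatorname{Forb}(\mathcal{F})$ is the class of graphs containing no induced subgraph isomorphic to a member of $\mathcal{F}$. The class of threshold graphs is $\operatorname{Forb}(2K_2,P_4,C_4)$, where $2K_2$ is the disjoint union of two edges, $P_4$ is the path on 4 vertices and $C_4$ is the cycle on 4 vertices. *)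

(* Defs.v *)
From mathcomp Require Import all_boot all_order all_algebra all_field.

Set Implicit Arguments.
Unset Strict Implicit.
Unset Printing Implicit Defensive.

Import GRing.Theory.
Local Open Scope ring_scope.

Record sgraph := SGraph {
  vertex :> finType;
  edge : rel vertex;
  edge_sym : symmetric edge;
  edge_irrefl : irreflexive edge }.

Section Complement.
Variable G : sgraph.
Definition compl_edge : rel G := fun x y => (x != y) && ~~ edge x y.
Fact compl_edge_sym : symmetric compl_edge.
Proof. by move=> x y; rewrite /compl_edge eq_sym edge_sym. Qed.
Fact compl_edge_irrefl : irreflexive compl_edge.
Proof. by move=> x; rewrite /compl_edge eqxx. Qed.
Definition complement := SGraph compl_edge_sym compl_edge_irrefl.
End Complement.

Section Induced.
Variables (G : sgraph) (S : {set G}).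
Definition induced_edge : rel {x : G | x \in S} :=
  fun x y => edge (val x) (val y).
Fact induced_edge_sym : symmetric induced_edge.
Proof. by move=> x y; apply: edge_sym. Qed.
Fact induced_edge_irrefl : irreflexive induced_edge.
Proof. by move=> x; apply: edge_irrefl. Qed.
Definition induced := SGraph induced_edge_sym induced_edge_irrefl.
End Induced.

Definition isomorphic (G H : sgraph) : Prop :=
  exists2 f : G -> H, bijective f & forall x y, edge (f x) (f y) = edge x y.

Definition Forb (F : sgraph -> Prop) (G : sgraph) : Prop :=
  forall (K : sgraph) (S : {set G}), F K -> ~ isomorphic (induced S) K.

Section DisjointUnion.
Variables G H : sgraph.
Definition union_edge : rel (G + H)%type := fun u v =>
  match u, v with
  | inl x, inl y => edge x y
  | inr x, inr y => edge x y
  | _, _ => false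
  end.
Fact union_edge_sym : symmetric union_edge.
Proof. by case=> x [] y //=; apply: edge_sym. Qed.
Fact union_edge_irrefl : irreflexive union_edge.
Proof. by case=> x /=; apply: edge_irrefl. Qed.
Definition disjoint_union := SGraph union_edge_sym union_edge_irrefl.
End DisjointUnion.

Section SmallGraphs.
Variable n : nat.

Definition complete_edge : rel 'I_n := fun i j => i != j.
Fact complete_edge_sym : symmetric complete_edge.
Proof. by move=> i j; apply: (congr1 negb (eq_sym i j)). Qed.
Fact complete_edge_irrefl : irreflexive complete_edge.
Proof. by move=> i; rewrite /complete_edge eqxx. Qed.
Definition complete_graph := SGraph complete_edge_sym complete_edge_irrefl.

Definition path_edge : rel 'I_n :=
  fun i j => (i.+1 == j :> nat) || (j.+1 == i :> nat).
Fact path_edge_sym : symmetric path_edge.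
Proof. by move=> i j; apply: orbC. Qed.
Fact path_edge_irrefl : irreflexive path_edge.
Proof. by move=> i; rewrite /path_edge orbb gtn_eqF. Qed.
Definition path_graph := SGraph path_edge_sym path_edge_irrefl.

(* ordS i is i + 1 modulo n; the test i != j only matters for n = 1. *)
Definition cycle_edge : rel 'I_n :=
  fun i j => (i != j) && ((j == ordS i) || (i == ordS j)).
Fact cycle_edge_sym : symmetric cycle_edge.
Proof. by move=> i j; rewrite /cycle_edge eq_sym orbC. Qed.
Fact cycle_edge_irrefl : irreflexive cycle_edge.
Proof. by move=> i; rewrite /cycle_edge eqxx. Qed.
Definition cycle_graph := SGraph cycle_edge_sym cycle_edge_irrefl.
End SmallGraphs.

Definition two_K2 := disjoint_union (complete_graph 2) (complete_graph 2).
Definition P4 := path_graph 4.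
Definition C4 := cycle_graph 4.

Definition threshold : sgraph -> Prop :=
  Forb (fun K => [\/ K = two_K2, K = P4 | K = C4]).

Definition adjacency (G : sgraph) : 'M[algC]_#|vertex G| :=
  \matrix_(i, j) (edge (enum_val i) (enum_val j))%:R.

(* The eigenvalues of a square matrix, repeated according to multiplicity. The
   order of the list is arbitrary: compare spectra with perm_eq. As adjacency
   matrices have integer entries, all their eigenvalues lie in algC. *)
Definition eigenvalues n (A : 'M[algC]_n) : seq algC :=
  sval (closed_field_poly_normal (char_poly A)).

Lemma char_poly_eigenvalues n (A : 'M[algC]_n) :
  char_poly A = \prod_(a <- eigenvalues A) ('X - a%:P).
Proof.
rewrite /eigenvalues; case: closed_field_poly_normal => s /= ->.
by rewrite (monicP (char_poly_monic A)) scale1r.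
Qed.

Lemma mem_eigenvalues n (A : 'M[algC]_n) : eigenvalues A =i eigenvalue A.
Proof.
move=> a; rewrite -[RHS]topredE /= eigenvalue_root_char char_poly_eigenvalues.
by rewrite root_prod_XsubC.
Qed.

Lemma size_eigenvalues n (A : 'M[algC]_n) : size (eigenvalues A) = n.
Proof.
have := size_char_poly A; rewrite char_poly_eigenvalues size_prod_XsubC.
by case.
Qed.

Definition spectrum (G : sgraph) : seq algC := eigenvalues (adjacency G).

Definition cospectral (G H : sgraph) : Prop :=
  perm_eq (spectrum G) (spectrum H).

Definition generalized_cospectral (G H : sgraph) : Prop :=
  cospectral G H /\ cospectral (complement G) (complement H).

Definition generalized_spectrally_closed (C : sgraph -> Prop) : Prop :=
  forall G H : sgraph, C G -> generalized_cospectral G H -> C H.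

(* Main.v *)
(* Let A and B be the adjacency matrices of G and of its complement, so that
   A + B = J - 1 with J the all-ones matrix. The trace of ABAB counts the
   (a, b, c, d) with ab, cd edges and bc, da edges of the complement; such
   vertices are automatically distinct, and according to the status of ac and
   bd they induce 2K2, P4 or C4. So G is threshold iff tr(ABAB) = 0. Expanding
   B = J - A - 1 and using JXJ = tr(XJ) J, the number tr(ABAB) is a polynomial
   in the traces tr(A^k) for k <= 4 and the walk counts tr(A^k J) for k <= 3.
   The spectrum gives the former, and the expansions of tr((J - A)^k) =
   tr((1 + B)^k) for k = 2, 3, 4 then determine the latter one by one. *)
Require Import Defs.
From mathcomp Require Import all_boot all_order all_algebra all_field.
From mathcomp Require Import spectral ring.

Set Implicit Arguments.
Unset Strict Implicit.
Unset Printing Implicit Defensive.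

Import GRing.Theory Num.Theory.
Local Open Scope ring_scope.

(** * Traces of powers of a normal matrix as power sums of eigenvalues *)

Lemma exprmx_conj_diag (R : comUnitRingType) n (P : 'M[R]_n) (d : 'rV[R]_n) k :
    P \in unitmx ->
  (invmx P *m diag_mx d *m P) ^+ k =
    invmx P *m diag_mx (\row_i d 0 i ^+ k) *m P.
Proof.
move=> Pu; elim: k => [|k IHk].
  rewrite expr0; set D := diag_mx _; have ->: D = 1%:M.
    by apply/matrixP=> i j; rewrite !mxE expr0.
  by rewrite mulmx1 mulVmx.
rewrite exprS IHk -[_ * _]/(_ *m _) !mulmxA mulmxK // -(mulmxA _ (diag_mx d)).
rewrite mulmx_diag; congr (_ *m diag_mx _ *m _).
by apply/rowP=> i; rewrite !mxE exprS.
Qed.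

Lemma char_poly_conjmx (R : comUnitRingType) n (P A : 'M[R]_n) :
  P \in unitmx -> char_poly (invmx P *m A *m P) = char_poly A.
Proof.
move=> Pu; rewrite /char_poly /char_poly_mx.
have PPi : map_mx polyC (invmx P) *m map_mx polyC P = 1%:M.
  by rewrite -map_mxM mulVmx // map_mx1.
have ->: 'X%:M - map_mx polyC (invmx P *m A *m P) =
    map_mx polyC (invmx P) *m ('X%:M - map_mx polyC A) *m map_mx polyC P.
  rewrite mulmxBr mulmxBl -!map_mxM; congr (_ - _).
  by rewrite mul_mx_scalar -scalemxAl PPi scalemx1.
by rewrite !det_mulmx mulrAC -det_mulmx PPi det1 mul1r.
Qed.

(** Normality provides a diagonalisation. Conjugation preserves traces and the characteristic
    polynomial, and the latter determines its roots as a multiset, so the diagonal is a reordering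
    of [eigenvalues A]. *)
Lemma mxtrace_exp_eigenvalues n (A : 'M[algC]_n) k :
  A \is normalmx -> \tr (A ^+ k) = \sum_(a <- eigenvalues A) a ^+ k.
Proof.
move=> /orthomx_spectralP; set P := spectralmx A; set d := spectral_diag A.
have Pu : P \in unitmx by apply: spectral_unit.
move=> defA; have eigA : perm_eq (eigenvalues A) [seq d 0 i | i : 'I_n].
  apply: prod_XsubC_eq; rewrite -char_poly_eigenvalues defA char_poly_conjmx //.
  rewrite char_poly_trig ?diag_mx_is_trig // big_image /=.
  by apply: eq_bigr => i _; rewrite mxE eqxx.
rewrite (perm_big _ eigA) big_image /= defA exprmx_conj_diag //.
rewrite mxtrace_mulC mulKVmx // mxtrace_diag.
by apply: eq_bigr => i _; rewrite mxE.
Qed.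

(** * Trace identities involving the all-ones matrix *)

Lemma mulmx_const1 (R : comPzRingType) n (X : 'M[R]_n) (J := const_mx 1) :
  J *m X *m J = \tr (X *m J) *: J.
Proof.
(* Every entry of [J *m X *m J] is the sum of all entries of [X], and so is [\tr (X *m J)]. *)
apply/matrixP=> i j; rewrite !mxE mulr1 /mxtrace.
rewrite (eq_bigr (fun k => \sum_l X l k)); last first.
  by move=> k _; rewrite !mxE mulr1; apply: eq_bigr => l _; rewrite mxE mul1r.
rewrite exchange_big; apply: eq_bigr => k _; rewrite mxE.
by apply: eq_bigr => l _; rewrite mxE mulr1.
Qed.

Section AllOnes.
Variables (R : comPzRingType) (n : nat) (A : 'M[R]_n).

Let J : 'M[R]_n := const_mx 1.
Let w k := \tr (A ^+ k * J).

Let JXJ (X : 'M[R]_n) : J * X * J = \tr (X * J) *: J.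
Proof. exact: mulmx_const1. Qed.

Let trC (X Y : 'M[R]_n) : \tr (X * Y) = \tr (Y * X).
Proof. exact: mxtrace_mulC. Qed.

Let trJ : \tr J = n%:R.
Proof.
rewrite /mxtrace (eq_bigr (fun=> 1)) ?sumr_const ?card_ord //.
by move=> i _; rewrite mxE.
Qed.

Let JJ : J * J = n%:R *: J.
Proof. by rewrite -[X in X * J]mulr1 JXJ mul1r trJ. Qed.

Let sqrM : (J - A) * (J - A) = n%:R *: J - J * A - A * J + A * A.
Proof. by rewrite mulrBl !mulrBr JJ opprD opprK addrA. Qed.

Let scaleAl a (X Y : 'M[R]_n) : a *: X * Y = a *: (X * Y).
Proof. exact/esym/scalemxAl. Qed.

Let scaleAr a (X Y : 'M[R]_n) : X * (a *: Y) = a *: (X * Y).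
Proof. exact/esym/scalemxAr. Qed.

Let JAJ : J * A * J = w 1 *: J.
Proof. exact: JXJ. Qed.

Let JAAJ : J * A * A * J = w 2 *: J.
Proof. by rewrite -(mulrA J) JXJ. Qed.

(** Products are nested to the left, so a preceding [A] hides [J * J] and [J * A * J] from
    rewriting; this rule and [AJAJ] are the prefixed variants. *)
Let AJJ : A * J * J = n%:R *: (A * J).
Proof. by rewrite -mulrA JJ scaleAr. Qed.

Let AJAJ : A * J * A * J = w 1 *: (A * J).
Proof. by rewrite -!mulrA (mulrA J) JAJ scaleAr. Qed.

Let reduceJ := (JJ, AJJ, JAJ, JAAJ, AJAJ, scaleAl).

Let tr_AJ : \tr (A * J) = w 1.
Proof. by []. Qed.

Let tr_JA : \tr (J * A) = w 1.
Proof. exact: trC. Qed.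

Let tr_AAJ : \tr (A * A * J) = w 2.
Proof. by []. Qed.

Let tr_JAA : \tr (J * A * A) = w 2.
Proof. by rewrite -mulrA trC. Qed.

Let tr_AJA : \tr (A * J * A) = w 2.
Proof. by rewrite trC mulrA. Qed.

Let tr_AAAJ : \tr (A * A * A * J) = w 3.
Proof. by rewrite /w !exprS expr0 mulr1 !mulrA. Qed.

Let tr_AAJA : \tr (A * A * J * A) = w 3.
Proof. by rewrite trC !mulrA. Qed.

Let tr_AJAA : \tr (A * J * A * A) = w 3.
Proof. by rewrite trC !mulrA. Qed.

Let tr_JAAA : \tr (J * A * A * A) = w 3.
Proof. by rewrite trC !mulrA. Qed.

Let trE := (mxtraceZ, trJ, tr_AJ, tr_JA, tr_AAJ, tr_JAA, tr_AJA,
  tr_AAAJ, tr_AAJA, tr_AJAA, tr_JAAA).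

Lemma mxtrace_sub_const2 :
  \tr ((J - A) ^+ 2) = n%:R ^+ 2 - 2 * w 1 + \tr (A ^+ 2).
Proof. by rewrite !expr2 sqrM !(raddfD, raddfN) /= !trE; ring. Qed.

Lemma mxtrace_sub_const3 :
  \tr ((J - A) ^+ 3) =
    n%:R ^+ 3 - 3 * n%:R * w 1 + 3 * w 2 - \tr (A ^+ 3).
Proof.
rewrite !exprSr !expr0 !mul1r sqrM !(mulrBr, mulrDl, mulrBl, mulNr).
by rewrite !reduceJ !(raddfD, raddfN) /= !trE; ring.
Qed.

Lemma mxtrace_sub_const4 :
  \tr ((J - A) ^+ 4) =
    n%:R ^+ 4 - 4 * n%:R ^+ 2 * w 1 + 4 * n%:R * w 2 + 2 * w 1 ^+ 2
    - 4 * w 3 + \tr (A ^+ 4).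
Proof.
(* Squaring [sqrM] starts from words in which [J * J] is already collapsed; [scaleAr] pulls out the
   scalar of the right factor. *)
rewrite (exprM _ 2 2) (expr2 (J - A)) sqrM !exprSr !expr0 !mul1r.
rewrite !(mulrBr, mulrDl, mulrDr, mulrBl, mulNr, mulrN) ?scaleAr !mulrA.
by rewrite !reduceJ !(raddfD, raddfN) /= !trE; ring.
Qed.

Lemma mxtrace_alternating (B := J - A - 1) :
  \tr (A * B * A * B) =
    w 1 ^+ 2 - 2 * w 3 + \tr (A ^+ 4) - 2 * (w 2 - \tr (A ^+ 3)) + \tr (A ^+ 2).
Proof.
rewrite /B !exprSr !expr0 !mul1r !(mulrBr, mulrBl, mulNr, mulr1, mulrA).
by rewrite !reduceJ !(raddfD, raddfN) /= !trE; ring.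
Qed.

End AllOnes.

(** * Spectral invariance of the alternating trace *)

Lemma adjacency_complement (G : sgraph) :
  adjacency (complement G) = const_mx 1 - adjacency G - 1.
Proof.
apply/matrixP=> i j; rewrite !mxE /= /compl_edge (inj_eq enum_val_inj).
have [<-|_] /= := eqVneq i j; first by rewrite edge_irrefl subr0 subrr.
by case: edge; rewrite !subr0 ?subrr.
Qed.

Lemma adjacency_normal (G : sgraph) : adjacency G \is normalmx.
Proof.
apply: symmetric_normalmx.
  apply/is_hermitianmxP/matrixP=> i j.
  by rewrite expr0 scale1r map_mx_id // !mxE edge_sym.
by apply/mxOverP=> i j; rewrite mxE realn.
Qed.

Lemma cospectral_mxtrace_exp (G H : sgraph) k :
  cospectral G H -> \tr (adjacency G ^+ k) = \tr (adjacency H ^+ k).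
Proof.
move=> cGH; rewrite !mxtrace_exp_eigenvalues ?adjacency_normal //.
exact: perm_big.
Qed.

Lemma cospectral_card (G H : sgraph) : cospectral G H -> #|G| = #|H|.
Proof. by move=> /perm_size; rewrite !size_eigenvalues. Qed.

Definition alternating_trace (G : sgraph) : algC :=
  let A := adjacency G in let B := adjacency (complement G) in
  \tr (A * B * A * B).

Lemma generalized_cospectral_alternating_trace (G H : sgraph) :
  generalized_cospectral G H -> alternating_trace G = alternating_trace H.
Proof.
move=> [cGH cGHc]; rewrite /alternating_trace !adjacency_complement.
rewrite !mxtrace_alternating !(cospectral_mxtrace_exp _ cGH).
pose M (K : sgraph) : 'M[algC]_#|K| := const_mx 1 - adjacency K.
have trM k : \tr (M G ^+ k) = \tr (M H ^+ k).
  have defM K : M K = adjacency (complement K) + 1.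
    by rewrite adjacency_complement subrK.
  (* The binomial expansion leaves only power traces of the complement. *)
  rewrite !defM !exprD1n !raddf_sum; apply: eq_bigr => i _ /=.
  by rewrite !raddfMn /= (cospectral_mxtrace_exp _ cGHc).
have two_neq0 : (2 : algC) != 0 by rewrite pnatr_eq0.
have three_neq0 : (3 : algC) != 0 by rewrite pnatr_eq0.
have four_neq0 : (4 : algC) != 0 by rewrite pnatr_eq0.
move: (trM 2%N) (trM 3%N) (trM 4%N); rewrite /M !mxtrace_sub_const2.
rewrite !mxtrace_sub_const3 !mxtrace_sub_const4.
have nGH : #|G|%:R = #|H|%:R :> algC by rewrite (cospectral_card cGH).
rewrite !(cospectral_mxtrace_exp _ cGH) nGH.
(* In each equation the outer terms already agree. What remains is -2, 3 or -4 times a walk count,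
   and each equality found is substituted into the equations that follow. *)
move=> /addIr/addrI/oppr_inj/(mulfI two_neq0)->.
move=> /addIr/addrI/(mulfI three_neq0)->.
by move=> /addIr/addrI/oppr_inj/(mulfI four_neq0)->.
Qed.

(** * Vanishing of the trace and alternating 4-cycles *)

Definition alternating_cycle (G : sgraph) (a b c d : G) :=
  [&& edge a b, compl_edge b c, edge c d & compl_edge d a].

Lemma alternating_trace_eq0 (G : sgraph) :
  alternating_trace G = 0 <-> forall a b c d : G, ~~ alternating_cycle a b c d.
Proof.
pose C (i j k l : 'I_#|G|) : bool :=
  alternating_cycle (enum_val i) (enum_val j) (enum_val k) (enum_val l).
(* The order of summation is that of unfolding the left-nested product from its last factor
   inwards. *)
have ->: alternating_trace G = \sum_i \sum_l \sum_k \sum_j (C i j k l)%:R.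
  apply: eq_bigr => i _; rewrite mxE; apply: eq_bigr => l _.
  rewrite mxE mulr_suml; apply: eq_bigr => k _; rewrite mxE !mulr_suml.
  apply: eq_bigr => j _; rewrite !mxE /= -!natrM !mulnb.
  by rewrite /C /alternating_cycle !andbA.
split=> [C0 a b c d | noC]; last first.
  do 4!(apply: big1 => ? _).
  by rewrite /C (negPf (noC _ _ _ _)).
suff: (C (enum_rank a) (enum_rank b) (enum_rank c) (enum_rank d))%:R = 0
    :> algC.
  rewrite /C !enum_rankK; case: alternating_cycle => // /eqP.
  by rewrite oner_eq0.
(* A vanishing sum of nonnegative terms has only zero terms; the four sums are peeled off one at a
   time. *)
have C1 : \sum_l \sum_k \sum_j (C (enum_rank a) j k l)%:R = 0 :> algC.
  apply: (psumr_eq0P _ C0) => // i _.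
  by do 3!(apply: sumr_ge0 => ? _); apply: ler0n.
have C2 : \sum_k \sum_j (C (enum_rank a) j k (enum_rank d))%:R = 0 :> algC.
  apply: (psumr_eq0P _ C1) => // i _.
  by do 2!(apply: sumr_ge0 => ? _); apply: ler0n.
have C3 : \sum_j (C (enum_rank a) j (enum_rank c) (enum_rank d))%:R = 0 :> algC.
  apply: (psumr_eq0P _ C2) => // i _.
  by apply: sumr_ge0 => ? _; apply: ler0n.
by apply: (psumr_eq0P _ C3) => // i _; apply: ler0n.
Qed.

(** * Threshold graphs and alternating 4-cycles *)

Definition embedding (K G : sgraph) (h : K -> G) :=
  injective h /\ forall x y, edge (h x) (h y) = edge x y.

(** Trades vertex subsets for maps: an inverse isomorphism followed by inclusion is an embedding,
    and conversely an injective [h] is a bijection onto its image by counting. *)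
Lemma induced_embedding (K G : sgraph) :
  (exists S : {set G}, isomorphic (induced S) K) <-> exists h, @embedding K G h.
Proof.
split=> [[S [f [g fK gK] fE]] | [h [h_inj hE]]].
  exists (fun x => val (g x)); split=> [x y /val_inj | x y].
    exact: can_inj gK _ _.
  by rewrite -{2}(gK x) -{2}(gK y) fE.
exists [set h x | x in K].
have hS x : h x \in [set h y | y in K] by apply: imset_f.
pose g x : induced [set h y | y in K] := exist _ (h x) (hS x).
have g_inj : injective g by move=> x y /(congr1 val)/h_inj.
have [f gK fK] : bijective g.
  by apply: inj_card_bij g_inj _; rewrite card_sig card_imset.
exists f; first by exists g.
by move=> x y; rewrite -{2}(fK x) -{2}(fK y) [RHS]hE.
Qed.

Lemma embedding_alternating_cycle (K G : sgraph) (h : K -> G) a b c d :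
    embedding h ->
  alternating_cycle (h a) (h b) (h c) (h d) = alternating_cycle a b c d.
Proof.
by case=> h_inj hE; rewrite /alternating_cycle /compl_edge !hE !(inj_eq h_inj).
Qed.

(** Serves both [P4] and [C4]. The default [a] is never reached, since [s] has length 4. *)
Lemma nth_embedding (e : rel 'I_4) esym eirr (G : sgraph) (s : seq G) a :
    uniq s -> size s = 4%N ->
    (forall i j : 'I_4, edge (nth a s i) (nth a s j) = e i j) ->
  @embedding (@SGraph 'I_4 e esym eirr) G (fun i : 'I_4 => nth a s i).
Proof.
move=> s_uniq s4 sE; split=> // i j /eqP.
by rewrite nth_uniq ?s4 ?ltn_ord // => /eqP/val_inj.
Qed.

Lemma thresholdP (G : sgraph) :
  threshold G <-> forall a b c d : G, ~~ alternating_cycle a b c d.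
Proof.
split=> [thrG a b c d | noC K S FK isoK]; last first.
  have [h hP] : exists h, @embedding K G h.
    by apply/induced_embedding; exists S.
  have noCK x y z t : ~~ @alternating_cycle K x y z t.
    by rewrite -(embedding_alternating_cycle _ _ _ _ hP).
  case: FK => defK; subst K.
  - by have /negP[] := noCK (inl ord0) (inl ord_max) (inr ord0) (inr ord_max).
  (* The edges 10 and 23 of the path are joined by the pairs 02 and 31, at distance two; the same
     choice works in [C4]. *)
  - have /negP[] := noCK (inord 1) (inord 0) (inord 2) (inord 3).
    rewrite /alternating_cycle /compl_edge /= /path_edge.
    by rewrite -!val_eqE /= !inordK.
  - have /negP[] := noCK (inord 1) (inord 0) (inord 2) (inord 3).
    rewrite /alternating_cycle /compl_edge /= /cycle_edge.
    by rewrite -!val_eqE /= !inordK.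
apply/negP=> /and4P[ab /andP[b_c /negPf bc] cd /andP[d_a /negPf da]].
have forb K h : [\/ K = two_K2, K = P4 | K = C4] -> ~ @embedding K G h.
  move=> FK hP; have [S] : exists S : {set G}, isomorphic (induced S) K.
    by apply/induced_embedding; exists h.
  exact: thrG FK.
have a_b : a != b by apply: contraTneq ab => ->; rewrite edge_irrefl.
have c_d : c != d by apply: contraTneq cd => ->; rewrite edge_irrefl.
(* If [a = c], the edge [ab] would be the non-edge [bc]; likewise [b = d] would identify it with
   [da]. *)
have a_c : a != c by apply: contraTneq ab => ->; rewrite edge_sym bc.
have b_d : b != d by apply: contraTneq ab => ->; rewrite edge_sym da.
have ba : edge b a by rewrite edge_sym.
have cb : edge c b = false by rewrite edge_sym.
have dc : edge d c by rewrite edge_sym.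
have ad : edge a d = false by rewrite edge_sym.
have neqE := (negPf a_b, negPf c_d, negPf a_c, negPf b_d, negPf b_c, negPf d_a,
  eq_sym b a, eq_sym d c, eq_sym c a, eq_sym d b, eq_sym c b, eq_sym a d).
have edgesE := (ab, ba, bc, cb, cd, dc, da, ad, @edge_irrefl G).
(* Both diagonals present give the cycle a, b, d, c; exactly one gives a path with that diagonal in
   the middle; none gives two disjoint edges. *)
case ac: (edge a c) (edge_sym c a) => ca;
  case bd: (edge b d) (edge_sym d b) => db.
- apply: (forb C4 (fun i : 'I_4 => nth a [:: a; b; d; c] i)); first exact: Or33.
  apply: nth_embedding => //; first by rewrite /= !inE !neqE.
  by case=> [[|[|[|[|?]]]] ?] // [[|[|[|[|?]]]] ?] //=;
     rewrite ?(edgesE, ac, bd, ca, db).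
- apply: (forb P4 (fun i : 'I_4 => nth a [:: b; a; c; d] i)); first exact: Or32.
  apply: nth_embedding => //; first by rewrite /= !inE !neqE.
  by case=> [[|[|[|[|?]]]] ?] // [[|[|[|[|?]]]] ?] //=;
     rewrite ?(edgesE, ac, bd, ca, db).
- apply: (forb P4 (fun i : 'I_4 => nth a [:: a; b; d; c] i)); first exact: Or32.
  apply: nth_embedding => //; first by rewrite /= !inE !neqE.
  by case=> [[|[|[|[|?]]]] ?] // [[|[|[|[|?]]]] ?] //=;
     rewrite ?(edgesE, ac, bd, ca, db).
pose h (x : two_K2) := match x with
  | inl i => nth a [:: a; b] i | inr i => nth a [:: c; d] i end.
apply: (forb two_K2 h); first exact: Or31.
split.
  (* Distinct vertices are separated by [neqE]; in the other cases the ordinals differ only in their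
     bound proofs. *)
  by case=> [] [[|[|?]] ?] // [] [[|[|?]] ?] //= /eqP;
     rewrite ?neqE // => _; congr (_ _); apply: val_inj.
by case=> [] [[|[|?]] ?] // [] [[|[|?]] ?] //=;
   rewrite ?(edgesE, ac, bd, ca, db).
Qed.

Theorem theorem1p2 : generalized_spectrally_closed threshold.
Proof.
move=> G H /thresholdP thrG /generalized_cospectral_alternating_trace trGH.
apply/thresholdP/alternating_trace_eq0; rewrite -trGH.
exact/alternating_trace_eq0.
Qed.
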